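(* Let $[f],[g]$ be two distinct proper non-empty real projective conics, generating a pencil in one of the orbits I, Ia, II, IIa, III. Then $\{[f],[g]\}$ is in the class N if and only if $$\Phi_{30}\Phi_{12}>0\quad\text{and}\quad\Phi_{03}\Phi_{21}>0.$$
   Context: For a non-zero real ternary quadratic form $f$, $[f]\in\mathbb{P}(S^2{\mathbb{R}^3}^* )$ is the associated algebraic conic; it is proper if $f$ is non-degenerate (degenerate otherwise), and non-empty if its zero locus in $\mathbb{RP}^2$ is non-empty. The pencil generated by two distinct conics is the projective line through them in $\mathbb{P}(S^2{\mathbb{R}^3}^* )$. Orbits of pencils are under $PGL(3,\mathbb{R})$; representatives are the pencils generated by: I: $x^2-y^2,\ x^2-z^2$; Ia: $x^2+y^2+z^2,\ xz$; II: $yz,\ x(y-z)$; IIa: $y^2+z^2,\ xz$; III: $xz,\ y^2$. The degenerate conics of a pencil cut it (topologically a circle) into arcs, the connected components of the set of its proper conics. For pairs of distinct proper non-empty conics generating a pencil in one of these orbits, there are two classes under rigid isotopy and exchange of the two conics: class N (''neighbors''), when the two conics are on a same arc of the pencil they generate, and class S (''separated''), when they are on distinct arcs. (Rigid isotopy: a path in the space of couples of distinct proper conics along which the numbers of real and imaginary intersection points of each multiplicity do not change.) $\Phi_{ij}$ are the coefficients of the characteristic form: $\det\mathrm{Matrix}(tf+ug)=\Phi_{30}t^3+\Phi_{21}t^2u+\Phi_{12}tu^2+\Phi_{03}u^3$, where $\mathrm{Matrix}(q)$ is the symmetric matrix of $q$. *)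

(* Defs.v *)
From HB Require Import structures.
From mathcomp Require Import all_boot all_order all_algebra generic_quotient.
From mathcomp Require Import all_classical all_reals all_analysis.
From mathcomp Require Import ring.

Set Implicit Arguments.
Unset Strict Implicit.
Unset Printing Implicit Defensive.

Import Order.TTheory GRing.Theory Num.Theory.
Import numFieldNormedType.Exports.

Local Open Scope classical_set_scope.
Local Open Scope ring_scope.
Local Open Scope quotient_scope.

(* A real ternary quadratic form is represented by its symmetric matrix. *)

Definition qeval (R : realType) (M : 'M[R]_3) (v : 'cV[R]_3) : R :=
  (v^T *m M *m v) 0 0.

(* The matrix of a x^2 + b y^2 + c z^2 + d xy + e xz + h yz. *)
Definition qmx (R : realType) (a b c d e h : R) : 'M[R]_3 :=
  \matrix_(i < 3, j < 3)
    nth 0 (nth [::] [:: [:: a;     d / 2; e / 2];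
                        [:: d / 2; b;     h / 2];
                        [:: e / 2; h / 2; c    ]] i) j.

Lemma qmxE (R : realType) (a b c d e h : R) (v : 'cV[R]_3) :
  let x := v 0 0 in let y := v 1 0 in let z := v 2%:R 0 in
  qeval (qmx a b c d e h) v =
    a * x ^+ 2 + b * y ^+ 2 + c * z ^+ 2
    + d * (x * y) + e * (x * z) + h * (y * z).
Proof.
have -> : v 2%:R 0 = v (lift ord0 (lift ord0 ord0)) 0.
  by congr (v _ 0); apply/val_inj.
have -> : v 1 0 = v (lift ord0 ord0) 0.
  by congr (v _ 0); apply/val_inj.
rewrite /qeval /qmx !mxE !big_ord_recl big_ord0 /= !mxE.
rewrite !big_ord_recl !big_ord0 !mxE /=.
by field.
Qed.

(* Non-zero quadratic forms, with the topology induced by that of 'M[R]_3. *)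
Definition nzforms (R : realType) : set 'M[R]_3 :=
  [set M | M^T = M /\ M <> 0].

Definition nzform (R : realType) : Type := set_type (@nzforms R).
HB.instance Definition _ (R : realType) :=
  Topological.copy (nzform R) (set_type (@nzforms R)).

Definition mx_of_form (R : realType) (f : nzform R) : 'M[R]_3 := set_val f.
Coercion mx_of_form : nzform >-> matrix.

Definition proportional (R : realType) : rel (nzform R) :=
  fun f g => `[< exists2 k : R, k != 0 & (f : 'M[R]_3) = k *: (g : 'M[R]_3) >].

Lemma proportional_refl (R : realType) : reflexive (@proportional R).
Proof. by move=> f; apply/asboolP; exists 1; rewrite ?oner_eq0 ?scale1r. Qed.

Lemma proportional_sym (R : realType) : symmetric (@proportional R).
Proof.
suff H (f g : nzform R) : proportional f g -> proportional g f.
  by move=> f g; apply/idP/idP; exact: H.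
move=> /asboolP[k k0 fg]; apply/asboolP; exists k^-1; first by rewrite invr_eq0.
by rewrite fg scalerA mulVf // scale1r.
Qed.

Lemma proportional_trans (R : realType) : transitive (@proportional R).
Proof.
move=> g f h /asboolP[k k0 fg] /asboolP[l l0 gh]; apply/asboolP.
by exists (k * l); rewrite ?mulf_neq0// fg gh scalerA.
Qed.

Canonical proportional_equiv (R : realType) :=
  EquivRel (@proportional R) (@proportional_refl R) (@proportional_sym R)
    (@proportional_trans R).

(* The projective space of ternary quadratic forms, with the quotient topology. *)
Definition conic (R : realType) : Type :=
  quotient_topology {eq_quot @proportional R}.
HB.instance Definition _ (R : realType) := Topological.on (conic R).
HB.instance Definition _ (R : realType) := Quotient.on (conic R).

Definition conic_of (R : realType) (f : nzform R) : conic R := \pi_(conic R) f.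

Lemma conic_of_eq (R : realType) (f g : nzform R) :
  conic_of f = conic_of g <->
  exists2 k : R, k != 0 & (f : 'M[R]_3) = k *: (g : 'M[R]_3).
Proof.
split=> [/eqmodP/asboolP//|fg].
by apply/(@eqmodP _ (proportional_equiv R))/asboolP.
Qed.

Definition proper_form (R : realType) (f : nzform R) : Prop := \det f != 0.

Definition proper_conics (R : realType) : set (conic R) :=
  [set conic_of f | f in [set f | proper_form f]].

(* A point of RP^2 is the class of a non-zero vector. *)
Definition nonempty_form (R : realType) (f : nzform R) : Prop :=
  exists2 v : 'cV[R]_3, v != 0 & qeval f v = 0.

(* The projective line through [F] and [G], for F and G linearly independent
   symmetric matrices. *)
Definition pencil (R : realType) (F G : 'M[R]_3) : set (conic R) :=
  [set conic_of h | h in [set h : nzform R |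
    exists t u : R, (h : 'M[R]_3) = t *: F + u *: G]].

(* The action of GL(3,R), hence of PGL(3,R), by linear substitution
   of the variables. *)
Lemma subst_nzforms (R : realType) (A : 'M[R]_3) (uA : A \in unitmx)
  (f : nzform R) : A^T *m f *m A \in @nzforms R.
Proof.
case: f => M MP; rewrite /mx_of_form set_valE /=.
move/set_mem: MP => [Ms M0].
apply/mem_set; split; first by rewrite !trmx_mul trmxK Ms mulmxA.
move=> H; apply: M0.
have uAT : A^T \in unitmx by rewrite unitmx_tr.
have : invmx A^T *m (A^T *m M *m A) *m invmx A = 0.
  by rewrite H mulmx0 mul0mx.
by rewrite !mulmxA mulVmx // mul1mx -mulmxA mulmxV // mulmx1.
Qed.

Definition form_subst (R : realType) (A : 'M[R]_3) (uA : A \in unitmx)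
  (f : nzform R) : nzform R := exist _ (A^T *m f *m A) (subst_nzforms uA f).

Lemma form_substE (R : realType) (A : 'M[R]_3) (uA : A \in unitmx)
  (f : nzform R) (v : 'cV[R]_3) :
  qeval (form_subst uA f) v = qeval f (A *m v).
Proof. by rewrite /qeval /mx_of_form set_valE /= trmx_mul !mulmxA. Qed.

Definition conic_subst (R : realType) (A : 'M[R]_3) (uA : A \in unitmx)
  (c : conic R) : conic R := conic_of (form_subst uA (repr c)).

Lemma conic_substE (R : realType) (A : 'M[R]_3) (uA : A \in unitmx)
  (f : nzform R) :
  conic_subst uA (conic_of f) = conic_of (form_subst uA f).
Proof.
have /conic_of_eq[k k0 e] : conic_of (repr (conic_of f)) = conic_of f.
  by rewrite /conic_of reprK.
apply/conic_of_eq; exists k => //.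
rewrite {1}/mx_of_form set_valE /= e -scalemxAr -scalemxAl.
by rewrite /mx_of_form set_valE.
Qed.

Definition same_orbit (R : realType) (P Q : set (conic R)) : Prop :=
  exists (A : 'M[R]_3) (uA : A \in unitmx), P = conic_subst uA @` Q.

Variant pencil_orbit := OrbitI | OrbitIa | OrbitII | OrbitIIa | OrbitIII.

Definition orbit_rep (R : realType) (o : pencil_orbit) : set (conic R) :=
  match o with
  | OrbitI   => (* x^2 - y^2, x^2 - z^2 *)
      pencil (qmx 1 (-1) 0 0 0 0) (qmx 1 0 (-1) 0 0 0)
  | OrbitIa  => (* x^2 + y^2 + z^2, xz *)
      pencil (qmx 1 1 1 0 0 0) (qmx 0 0 0 0 1 0)
  | OrbitII  => (* yz, xy - xz *)
      pencil (qmx 0 0 0 0 0 1) (qmx 0 0 0 1 (-1) 0)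
  | OrbitIIa => (* y^2 + z^2, xz *)
      pencil (qmx 0 1 1 0 0 0) (qmx 0 0 0 0 1 0)
  | OrbitIII => (* xz, y^2 *)
      pencil (qmx 0 0 0 0 1 0) (qmx 0 1 0 0 0 0)
  end.

(* The arc of the pencil of [f] and [g] that contains [f]. *)
Definition pencil_arc (R : realType) (f g : nzform R) : set (conic R) :=
  connected_component (pencil f g `&` @proper_conics R) (conic_of f).

Definition class_N (R : realType) (f g : nzform R) : Prop :=
  pencil_arc f g (conic_of g).

(* The characteristic form det(t f + u g), as an element of R[u][t]: t is the
   outer variable 'X and u the inner variable 'X%:P. *)
Definition char_form (R : realType) (f g : 'M[R]_3) : {poly {poly R}} :=
  \det ('X *: map_mx (polyC \o polyC) f + 'X%:P *: map_mx (polyC \o polyC) g).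

Definition Phi (R : realType) (f g : 'M[R]_3) (i j : nat) : R :=
  (char_form f g)`_i`_j.

Definition det3 (S : comPzRingType) (r s q : nat -> S) : S :=
  r 0%N * (s 1%N * q 2%N - s 2%N * q 1%N)
  - r 1%N * (s 0%N * q 2%N - s 2%N * q 0%N)
  + r 2%N * (s 0%N * q 1%N - s 1%N * q 0%N).

Lemma det_mx33 (S : comPzRingType) (M : 'M[S]_3) :
  let m i j := M (inord i) (inord j) in \det M = det3 (m 0%N) (m 1%N) (m 2%N).
Proof.
move=> m; have -> : M = \matrix_(i < 3, j < 3) m i j.
  by apply/matrixP => i j; rewrite mxE /m !inord_val.
rewrite (expand_det_row _ ord0) !big_ord_recl big_ord0 /cofactor.
rewrite !(expand_det_row _ ord0) !big_ord_recl !big_ord0 /cofactor.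
rewrite !det_mx11 !mxE /= /bump /= ?add0n ?addn0 /det3 !exprS !expr0.
by ring.
Qed.

Lemma char_formE (R : realType) (f g : 'M[R]_3) (t u : R) :
  \det (t *: f + u *: g) =
    Phi f g 3 0 * t ^+ 3 + Phi f g 2 1 * (t ^+ 2 * u)
    + Phi f g 1 2 * (t * u ^+ 2) + Phi f g 0 3 * u ^+ 3.
Proof.
pose F i j : R := f (inord i) (inord j); pose G i j : R := g (inord i) (inord j).
pose c30 := det3 (F 0%N) (F 1%N) (F 2%N).
pose c21 := det3 (G 0%N) (F 1%N) (F 2%N) + det3 (F 0%N) (G 1%N) (F 2%N)
  + det3 (F 0%N) (F 1%N) (G 2%N).
pose c12 := det3 (F 0%N) (G 1%N) (G 2%N) + det3 (G 0%N) (F 1%N) (G 2%N)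
  + det3 (G 0%N) (G 1%N) (F 2%N).
pose c03 := det3 (G 0%N) (G 1%N) (G 2%N).
have Hp : char_form f g = c30%:P%:P * 'X^3 + (c21 *: 'X)%:P * 'X^2
    + (c12 *: 'X^2)%:P * 'X + (c03 *: 'X^3)%:P.
  rewrite /char_form det_mx33 /det3 !mxE /= -!/(F _ _) -!/(G _ _).
  rewrite /c30 /c21 /c12 /c03 /det3 -!mul_polyC.
  by ring.
have -> : Phi f g 3 0 = c30.
  by rewrite /Phi Hp; do 9 rewrite ?(coefD, coefCM, coefMX, coefXn, coefC,
    coefZ, coefX, coef0, mulr0, mul0r, mulr1, addr0, add0r) /=.
have -> : Phi f g 2 1 = c21.
  by rewrite /Phi Hp; do 9 rewrite ?(coefD, coefCM, coefMX, coefXn, coefC,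
    coefZ, coefX, coef0, mulr0, mul0r, mulr1, addr0, add0r) /=.
have -> : Phi f g 1 2 = c12.
  by rewrite /Phi Hp; do 9 rewrite ?(coefD, coefCM, coefMX, coefXn, coefC,
    coefZ, coefX, coef0, mulr0, mul0r, mulr1, addr0, add0r) /=.
have -> : Phi f g 0 3 = c03.
  by rewrite /Phi Hp; do 9 rewrite ?(coefD, coefCM, coefMX, coefXn, coefC,
    coefZ, coefX, coef0, mulr0, mul0r, mulr1, addr0, add0r) /=.
rewrite det_mx33 /det3 !mxE -!/(F _ _) -!/(G _ _) /c30 /c21 /c12 /c03 /det3.
by ring.
Qed.

(* Main.v *)
Require Import Defs.
From mathcomp Require Import all_boot all_order all_algebra.
From mathcomp Require Import all_classical all_reals all_analysis.
From mathcomp Require Import generic_quotient ring lra.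

Set Implicit Arguments.
Unset Strict Implicit.
Unset Printing Implicit Defensive.

Import Order.TTheory GRing.Theory Num.Theory.
Import numFieldNormedType.Exports.
Local Open Scope classical_set_scope.
Local Open Scope ring_scope.

(** In each of the five orbits the characteristic form splits over the reals:
    det(t f + u g) = c (a0 t + b0 u) (a1 t + b1 u) (a2 t + b2 u). This can be
    read off the representative, since a change of variables multiplies the
    characteristic form by a non-zero square and a change of generators of the
    pencil acts linearly on (t, u) ([same_orbit_splits]).

    The linear forms l_i = a_i t + b_i u vanish exactly at the degenerate conics
    of the pencil, and l_i(f) = a_i, l_i(g) = b_i. A product l_i l_j has a
    well-defined sign at each point of the projective line and is non-zero on
    proper conics, so it keeps its sign along an arc: if f and g are on one arc,
    then a_i a_j and b_i b_j have the same sign, that is, the products a_i b_i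
    all have the same sign ([class_N_same_sign]). Conversely, if these products
    have a common sign e, no l_i vanishes on the segment from f to e g, which
    joins the two conics through proper ones ([same_sign_class_N]).

    It remains to detect a common sign of the ratios x_i = a_i / b_i from the
    coefficients of the characteristic form. Up to positive factors,
    Phi_30 Phi_12 is e3(x) e1(x) and Phi_03 Phi_21 is e2(x), with e_k the
    elementary symmetric functions; both are positive if and only if the three
    ratios have the same sign ([same_sign_PhiP]). *)

(** * Splitting of the characteristic form *)

Section Splitting.
Variable R : realType.
Implicit Types (f g : nzform R) (a b : 'I_3 -> R).

Definition char_splits (F G : 'M[R]_3) c a b :=
  forall t u, \det (t *: F + u *: G) = c * \prod_i (a i * t + b i * u).

Lemma orbit_rep_splits (o : pencil_orbit) :
  exists (P Q : 'M[R]_3) (c : R) a b,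
    orbit_rep o = pencil P Q /\ char_splits P Q c a b.
Proof.
have coefs (P Q : 'M[R]_3) (c a0 a1 a2 b0 b1 b2 : R) :
    (forall t u, \det (t *: P + u *: Q) =
      c * ((a0 * t + b0 * u) * (a1 * t + b1 * u) * (a2 * t + b2 * u))) ->
    exists (P' Q' : 'M[R]_3) (c : R) a b,
      pencil P Q = pencil P' Q' /\ char_splits P' Q' c a b.
  move=> H; exists P, Q, c, (fun i => nth 0 [:: a0; a1; a2] i),
    (fun i => nth 0 [:: b0; b1; b2] i); split=> // t u.
  by rewrite H !big_ord_recl big_ord0 /=; ring.
(* For orbit Ia the form is t (t + u / 2) (t - u / 2); in the orbits II, IIa
   and III it is a monomial with one double root. *)
case: o => /=.
- apply: (coefs _ _ 1 1 (-1) 0 1 0 (-1)) => t u.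
  by rewrite det_mx33 /det3 !mxE !inordK //=; field.
- apply: (coefs _ _ 1 1 1 1 0 2^-1 (- 2^-1)) => t u.
  by rewrite det_mx33 /det3 !mxE !inordK //=; field.
- apply: (coefs _ _ (- 4^-1) 1 0 0 0 1 1) => t u.
  by rewrite det_mx33 /det3 !mxE !inordK //=; field.
- apply: (coefs _ _ (- 4^-1) 1 0 0 0 1 1) => t u.
  by rewrite det_mx33 /det3 !mxE !inordK //=; field.
- apply: (coefs _ _ (- 4^-1) 1 1 0 0 0 1) => t u.
  by rewrite det_mx33 /det3 !mxE !inordK //=; field.
Qed.

Lemma same_orbit_splits f g (o : pencil_orbit) :
  same_orbit (pencil f g) (orbit_rep o) ->
  exists (c : R) a b, char_splits f g c a b.
Proof.
move=> [A [uA PE]]; have [P [Q [c [a [b [oE dPQ]]]]]] := orbit_rep_splits o.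
have member (h : nzform R) : pencil f g (conic_of h) ->
    exists t u, (h : 'M[R]_3) = A^T *m (t *: P + u *: Q) *m A.
  rewrite PE oE => -[_ [h' [t [u h'E]] <-]].
  rewrite conic_substE => /esym/conic_of_eq[k _ hE].
  exists (k * t), (k * u).
  rewrite hE {1}/mx_of_form set_valE /= h'E.
  by rewrite -!scalerA -scalerDr -scalemxAr -scalemxAl.
have [|t1 [u1 fE]] := member f.
  by exists f => //; exists 1, 0; rewrite scale1r scale0r addr0.
have [|t2 [u2 gE]] := member g.
  by exists g => //; exists 0, 1; rewrite scale1r scale0r add0r.
exists (\det A ^+ 2 * c), (fun i => a i * t1 + b i * u1),
  (fun i => a i * t2 + b i * u2) => t u.
have -> : t *: (f : 'M[R]_3) + u *: (g : 'M[R]_3) =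
    A^T *m ((t * t1 + u * t2) *: P + (t * u1 + u * u2) *: Q) *m A.
  rewrite fE gE scalemxAl scalemxAr scalemxAl scalemxAr -mulmxDl -mulmxDr.
  by congr (_ *m _ *m _); apply/matrixP => i j; rewrite !mxE; ring.
rewrite !det_mulmx det_tr dPQ.
have -> : \prod_i (a i * (t * t1 + u * t2) + b i * (t * u1 + u * u2)) =
    \prod_i ((a i * t1 + b i * u1) * t + (a i * t2 + b i * u2) * u).
  by apply: eq_bigr => i _; ring.
by ring.
Qed.

Lemma Phi_splits (f g : 'M[R]_3) (c : R) a b :
  char_splits f g c a b ->
  [/\ Phi f g 3 0 = c * (a 0 * a 1 * a 2%:R),
      Phi f g 2 1 = c * (b 0 * a 1 * a 2%:R + a 0 * b 1 * a 2%:R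
                         + a 0 * a 1 * b 2%:R),
      Phi f g 1 2 = c * (a 0 * b 1 * b 2%:R + b 0 * a 1 * b 2%:R
                         + b 0 * b 1 * a 2%:R)
    & Phi f g 0 3 = c * (b 0 * b 1 * b 2%:R)].
Proof.
move=> split; have H t u : Phi f g 3 0 * t ^+ 3 + Phi f g 2 1 * (t ^+ 2 * u)
    + Phi f g 1 2 * (t * u ^+ 2) + Phi f g 0 3 * u ^+ 3 =
    c * ((a 0 * t + b 0 * u) * (a 1 * t + b 1 * u) * (a 2%:R * t + b 2%:R * u)).
  rewrite -char_formE split !big_ord_recl big_ord0 mulr1 !mulrA.
  have -> : lift ord0 (lift ord0 ord0) = 2%:R :> 'I_3 by apply/val_inj.
  by have -> : lift ord0 ord0 = 1 :> 'I_3 by apply/val_inj.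
(* A binary cubic form is determined by its values at four distinct
   points of the projective line. *)
have h10 := H 1 0; have h01 := H 0 1; have h11 := H 1 1; have h1N := H 1 (-1).
by split; lra.
Qed.

End Splitting.

(** * Signs of the roots *)

Section Signs.
Variable R : realType.

(** If x y <= 0, then e2 > 0 forces z (x + y) >= 0, whence
    e3 e1 = x y (z (x + y) + z ^ 2) <= 0. *)
Lemma same_sign_esym (x y z : R) :
  0 < x * y * z * (x + y + z) -> 0 < x * y + x * z + y * z -> 0 < x * y.
Proof.
move=> e31 e2; rewrite ltNge; apply/negP => xy0.
have zD : 0 <= z * (x + y) + z ^+ 2.
  by apply: addr_ge0; [lra | exact: sqr_ge0].
suff : x * y * z * (x + y + z) <= 0 by rewrite leNgt e31.
rewrite (_ : _ * _ = x * y * (z * (x + y) + z ^+ 2)); last by ring.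
exact: mulr_le0_ge0.
Qed.

(** Divided by the positive square of c b0 b1 b2, the two expressions on the
    right are e3 e1 and e2 of the ratios a_i / b_i. *)
Lemma same_sign_PhiP (c a0 a1 a2 b0 b1 b2 : R) :
  c != 0 -> b0 * b1 * b2 != 0 ->
  [/\ 0 < (a0 * b0) * (a1 * b1), 0 < (a0 * b0) * (a2 * b2)
     & 0 < (a1 * b1) * (a2 * b2)] <->
  0 < c * (a0 * a1 * a2) * (c * (a0 * b1 * b2 + b0 * a1 * b2 + b0 * b1 * a2)) /\
  0 < c * (b0 * b1 * b2) * (c * (b0 * a1 * a2 + a0 * b1 * a2 + a0 * a1 * b2)).
Proof.
move=> c0; rewrite !mulf_eq0 !negb_or => /andP[/andP[b00 b10] b20].
have sqM (k x : R) : k != 0 -> (0 < k ^+ 2 * x) = (0 < x).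
  by move=> k0; rewrite pmulr_rgt0 // exprn_even_gt0.
set x := a0 / b0; set y := a1 / b1; set z := a2 / b2.
have -> : a0 = x * b0 by rewrite divfK.
have -> : a1 = y * b1 by rewrite divfK.
have -> : a2 = z * b2 by rewrite divfK.
pose k := c * (b0 * b1 * b2).
have k0 : k != 0 by rewrite !mulf_neq0.
rewrite (_ : c * (x * b0 * (y * b1) * (z * b2)) * _ =
  k ^+ 2 * (x * y * z * (x + y + z))); last by rewrite /k; ring.
rewrite (_ : c * (b0 * b1 * b2) * _ =
  k ^+ 2 * (x * y + x * z + y * z)); last by rewrite /k; ring.
have pairM (r s b b' : R) : b != 0 -> b' != 0 ->
    (0 < r * b * b * (s * b' * b')) = (0 < r * s).
  move=> b_0 b'_0; rewrite -(sqM (b * b') (r * s)) ?mulf_neq0 //.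
  by congr (0 < _); ring.
rewrite !sqM // !pairM //; split=> [[xy xz yz]|[e31 e2]].
  split; last by rewrite !addr_gt0.
  have -> : x * y * z * (x + y + z) =
    x ^+ 2 * (y * z) + y ^+ 2 * (x * z) + z ^+ 2 * (x * y) by ring.
  have x0 : x != 0 by apply: contraTneq xy => ->; rewrite mul0r ltxx.
  have y0 : y != 0 by apply: contraTneq xy => ->; rewrite mulr0 ltxx.
  have z0 : z != 0 by apply: contraTneq xz => ->; rewrite mulr0 ltxx.
  by rewrite !addr_gt0 // sqM.
split; first exact: same_sign_esym e31 e2.
- by apply: (@same_sign_esym x z y); lra.
- by apply: (@same_sign_esym y z x); lra.
Qed.

End Signs.

(** * Linear forms on a pencil *)

Section Arcs.
Variable R : realType.
Implicit Types (f g h : nzform R).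

Lemma independent_minor f g : conic_of f <> conic_of g ->
  exists i j k l, f i j * g k l - f k l * g i j != 0.
Proof.
move=> fg; apply: contrapT => minor0; apply: fg; apply/conic_of_eq.
have {}minor0 i j k l : f i j * g k l = f k l * g i j.
  apply/eqP; rewrite -subr_eq0; apply/negPn/negP => H.
  by apply: minor0; exists i, j, k, l.
have nz h : exists i j, h i j != 0.
  have [_ h0] := set_valP h.
  apply: contrapT => h0'; apply: h0; apply/matrixP => i j; rewrite [RHS]mxE.
  by apply/eqP/negPn/negP => ?; apply: h0'; exists i, j.
have [i [j gij]] := nz g; have [k [l fkl]] := nz f.
have fij : f i j != 0.
  apply/eqP => fij0; have /eqP[] := mulf_neq0 fkl gij.
  by rewrite -minor0 fij0 mul0r.
exists (f i j / g i j); first by rewrite mulf_neq0 // invr_eq0.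
by apply/matrixP => p q; rewrite !mxE mulrAC minor0 mulfK.
Qed.

Lemma continuous_mulf (T : topologicalType) (u v : T -> R) :
  continuous u -> continuous v -> continuous (fun x => u x * v x).
Proof. by move=> uc vc x; apply: cvgM; [exact: uc | exact: vc]. Qed.

Lemma continuous_lincomb (T : topologicalType) (p q : R) (u v : T -> R) :
  continuous u -> continuous v -> continuous (fun x => p * u x + q * v x).
Proof.
move=> uc vc x; apply: cvgD; (apply: cvgM; [exact: cvg_cst|]).
  exact: uc.
exact: vc.
Qed.

(** The coordinates t and u on the pencil are obtained by Cramer's rule from two
    entries of the matrix, so they extend to continuous linear functionals on
    all matrices. This is how the linear forms l_i, given on the pencil only,
    can be used to cut out open sets of conics. *)
Lemma pencil_functional f g (x y : R) : conic_of f <> conic_of g ->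
  exists L : 'M[R]_3 -> R, [/\ continuous L,
    forall k M, L (k *: M) = k * L M &
    forall t u, L (t *: (f : 'M[R]_3) + u *: (g : 'M[R]_3)) = x * t + y * u].
Proof.
move=> /independent_minor[i [j [k [l]]]]; set D := (X in X != 0) => D0.
exists (fun M => (x * g k l - y * f k l) / D * M i j
               + (y * f i j - x * g i j) / D * M k l); split.
- by apply: continuous_lincomb; exact: coord_continuous.
- by move=> r M; rewrite !mxE; ring.
- by move=> t u; rewrite !mxE /D; field.
Qed.

Lemma pencil_comb_eq0 f g (t u : R) : conic_of f <> conic_of g ->
  t *: (f : 'M[R]_3) + u *: (g : 'M[R]_3) = 0 -> t = 0 /\ u = 0.
Proof.
move=> fg tu0.
have [L [_ LZ LE]] := pencil_functional 1 0 fg.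
have [L' [_ L'Z L'E]] := pencil_functional 0 1 fg.
have := L'E t u; have := LE t u.
by rewrite tu0 -(scale0r 0) LZ L'Z; split; lra.
Qed.

(** * Arcs as sets of constant sign *)

Definition sign_locus (W : 'M[R]_3 -> R) : set (conic R) :=
  [set conic_of h | h in [set h : nzform R | 0 < W h]].

Lemma sign_locusE (W : 'M[R]_3 -> R) h :
  (forall k M, W (k *: M) = k ^+ 2 * W M) ->
  sign_locus W (conic_of h) <-> 0 < W h.
Proof.
move=> WZ; split=> [[h' Wh' /conic_of_eq[k k0 h'E]]|Wh]; last by exists h.
by move: Wh'; rewrite /= h'E WZ pmulr_rgt0 // exprn_even_gt0.
Qed.

(** Homogeneity of even degree makes the sign of [W] a function of the conic, so
    the preimage of the locus in the space of forms is the open set 0 < W. *)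
Lemma open_sign_locus (W : 'M[R]_3 -> R) : continuous W ->
  (forall k M, W (k *: M) = k ^+ 2 * W M) -> open (sign_locus W).
Proof.
move=> Wc WZ; rewrite /open /= /quotient_open.
have -> : \pi_(conic R)%qT @^-1` sign_locus W =
    ((fun h : nzform R => W h) @^-1` [set x | 0 < x]).
  by apply/seteqP; split=> h /= /(sign_locusE _ WZ).
apply: open_comp; last exact: open_gt.
move=> h _; apply: (@continuous_comp _ _ _ (@mx_of_form R) W); last exact: Wc.
exact: initial_continuous.
Qed.

(** On the pencil, l_i l_j is the quadratic function [W] of the matrix, and the
    loci where it has the sign it takes at f, or the opposite sign, are open and
    disjoint, and together they contain the proper conics of the pencil. A
    connected set of such conics containing f stays in the first one. *)
Lemma class_N_same_sign f g (c : R) (a b : 'I_3 -> R) (i j : 'I_3) :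
  conic_of f <> conic_of g -> char_splits f g c a b ->
  (forall i, a i != 0) -> class_N f g -> 0 < (a i * b i) * (a j * b j).
Proof.
move=> fg split a0 [C [Cf CA Cconn] Cg].
have [L [Lc LZ LE]] := pencil_functional (a i) (b i) fg.
have [L' [L'c L'Z L'E]] := pencil_functional (a j) (b j) fg.
pose W M := L M * L' M.
have WE t u : W (t *: (f : 'M[R]_3) + u *: (g : 'M[R]_3)) =
  (a i * t + b i * u) * (a j * t + b j * u) by rewrite /W LE L'E.
have WZ k M : W (k *: M) = k ^+ 2 * W M by rewrite /W LZ L'Z; ring.
have Wc : continuous W by apply: continuous_mulf.
have Wf : W f = a i * a j.
  by have := WE 1 0; rewrite scale1r scale0r addr0 => ->; ring.
have Wg : W g = b i * b j.
  by have := WE 0 1; rewrite scale1r scale0r add0r => ->; ring.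
have aij : a i * a j != 0 by rewrite mulf_neq0.
(* V is W normalised to be positive at f. *)
pose V M := a i * a j * W M.
have VZ k M : V (k *: M) = k ^+ 2 * V M by rewrite /V WZ; ring.
have VNZ k M : (- V (k *: M)) = k ^+ 2 * (- V M) by rewrite VZ; ring.
have Vc : continuous V.
  by apply: continuous_mulf Wc; exact: cst_continuous.
have VNc : continuous (fun M => - V M).
  by move=> M; apply: continuous_comp; [exact: Vc | exact: opp_continuous].
have cover : C `<=` sign_locus V `|` sign_locus (fun M => - V M).
  move=> _ /CA[[h [t [u hE]] <-]].
  move=> [h' h'p /conic_of_eq[k k0 h'E]].
  have : V h != 0.
    rewrite /V hE WE mulf_neq0 //.
    have : \det h' != 0 := h'p.
    rewrite h'E detZ hE split !mulf_eq0 !negb_or => /andP[_ /andP[_]].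
    by move=> /prodf_neq0 P0; rewrite !P0.
  rewrite neq_lt => /orP[] Vh; [right|left]; exists h => //=.
  by rewrite oppr_gt0.
have CV : C `&` sign_locus V = C.
  apply: Cconn.
  - exists (conic_of f); split=> //.
    by apply/(sign_locusE _ VZ); rewrite /V Wf -expr2 exprn_even_gt0.
  - by exists (sign_locus V) => //; apply: open_sign_locus.
  - exists (~` sign_locus (fun M => - V M)).
      by apply: open_closedC; apply: open_sign_locus.
    apply/seteqP; split=> [x [Cx Vx]|x [Cx nx]].
      split=> // VNx; move: Vx VNx => [h /= Vh <-] /(sign_locusE _ VNZ).
      by rewrite oppr_gt0 ltNge ltW.
    by split=> //; case: (cover x Cx).
have : sign_locus V (conic_of g) by move: Cg; rewrite -CV => -[].
by move/(sign_locusE _ VZ); rewrite /V Wg; congr (0 < _); ring.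
Qed.

(** Along the segment from f to e g, where e is the common sign of the a_i b_i,
    the form l_i takes the values (1 - x) a_i + x e b_i, whose product with a_i
    stays positive. *)
Lemma same_sign_class_N f g (c : R) (a b : 'I_3 -> R) :
  conic_of f <> conic_of g -> char_splits f g c a b -> c != 0 ->
  (forall i j, 0 < (a i * b i) * (a j * b j)) -> class_N f g.
Proof.
move=> fg split c0 ab.
have ab0 i : a i * b i != 0.
  by apply: contraTneq (ab i i) => ->; rewrite mul0r ltxx.
pose e := Num.sg (a 0 * b 0).
have e0 : e != 0 by rewrite sgr_eq0.
have eab i : 0 < e * (a i * b i).
  by rewrite -sgr_cp0 sgrM sgr_id -sgrM sgr_cp0.
pose m (x : R) : 'M[R]_3 :=
  (1 - x) *: (f : 'M[R]_3) + (x * e) *: (g : 'M[R]_3).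
(* Two distinct conics are linearly independent, so m x is non-zero for every
   real x and the path is defined on the whole line. *)
have mP x : m x \in @nzforms R.
  have [fs _] := set_valP f; have [gs _] := set_valP g.
  apply/mem_set; split; first by rewrite /m linearD !linearZ /= fs gs.
  move=> /(pencil_comb_eq0 fg)[x1 /eqP]; rewrite mulf_eq0 (negPf e0) orbF.
  by move=> /eqP x0; move/eqP: x1; rewrite x0 subr0 oner_eq0.
pose p (x : R) : nzform R := exist _ (m x) (mP x).
have pc : continuous p.
  apply: continuous_comp_initial.
  have -> : set_val \o p = m by [].
  move=> x; apply: cvgD; apply: cvgZr_tmp.
    by apply: cvgB; [exact: cvg_cst | exact: cvg_id].
  by apply: cvgM; [exact: cvg_id | exact: cvg_cst].
pose C := (@conic_of R \o p) @` `[0, 1].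
exists C; last first.
  exists 1; first by rewrite /= in_itv /= ler01 lexx.
  apply/conic_of_eq; exists e => //.
  by rewrite {1}/mx_of_form set_valE /= /m subrr scale0r add0r mul1r.
split.
- exists 0; first by rewrite /= in_itv /= ler01 lexx.
  apply/conic_of_eq; exists 1; first exact: oner_neq0.
  by rewrite {1}/mx_of_form set_valE /= /m subr0 mul0r scale0r addr0.
- move=> _ [x + <-]; rewrite /= in_itv /= => /andP[x0 x1].
  split; first by exists (p x) => //; exists (1 - x), (x * e).
  exists (p x) => //; rewrite /= /proper_form {1}/mx_of_form set_valE /= /m.
  rewrite split mulf_neq0 //; apply/prodf_neq0 => i _.
  have : 0 < (a i * (1 - x) + b i * (x * e)) * a i.
    have a2 : 0 < a i ^+ 2.
      rewrite exprn_even_gt0 //=.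
      by apply: contraNneq (ab0 i) => ->; rewrite mul0r.
    rewrite (_ : _ * a i = (1 - x) * a i ^+ 2 + x * (e * (a i * b i))).
      move: x0; rewrite le_eqVlt => /orP[/eqP<-|x0].
        by rewrite subr0 mul1r mul0r addr0.
      apply: ltr_wpDl; last by rewrite mulr_gt0.
      by rewrite mulr_ge0 ?subr_ge0 ?(ltW a2).
    by ring.
  by apply: contraTneq => ->; rewrite mul0r ltxx.
- apply: connected_continuous_connected; first exact: segment_connected.
  apply: continuous_subspaceT => x; apply: continuous_comp; first exact: pc.
  exact: pi_continuous.
Qed.

End Arcs.

(** * The criterion *)

Lemma ord3_ind (P : 'I_3 -> Prop) : P 0 -> P 1 -> P 2%:R -> forall i, P i.
Proof.
move=> P0 P1 P2 [[|[|[|//]]] lti]; [move: P0|move: P1|move: P2];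
  by congr (P _); apply/val_inj.
Qed.

Theorem proposition7 (R : realType) (f g : nzform R)
  (fg_distinct : conic_of f <> conic_of g)
  (f_proper : proper_form f) (g_proper : proper_form g)
  (f_nonempty : nonempty_form f) (g_nonempty : nonempty_form g)
  (fg_orbit : exists o : pencil_orbit, same_orbit (pencil f g) (orbit_rep o)) :
  class_N f g <->
  Phi f g 3 0 * Phi f g 1 2 > 0 /\ Phi f g 0 3 * Phi f g 2 1 > 0.
Proof.
have [orb /same_orbit_splits[c [a [b split]]]] := fg_orbit.
have fE : \det f = c * \prod_i a i.
  have := split 1 0; rewrite scale1r scale0r addr0 => ->.
  by congr (_ * _); apply: eq_bigr => i _; rewrite mulr1 mulr0 addr0.
have gE : \det g = c * \prod_i b i.
  have := split 0 1; rewrite scale1r scale0r add0r => ->.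
  by congr (_ * _); apply: eq_bigr => i _; rewrite mulr1 mulr0 add0r.
have /andP[c0 /prodf_neq0 a0] : (c != 0) && (\prod_i a i != 0).
  by move: f_proper; rewrite /proper_form fE mulf_eq0 negb_or.
have /andP[_ /prodf_neq0 b0] : (c != 0) && (\prod_i b i != 0).
  by move: g_proper; rewrite /proper_form gE mulf_eq0 negb_or.
have [-> -> -> ->] := Phi_splits split.
have b012 : b 0 * b 1 * b 2%:R != 0 by rewrite !mulf_neq0 ?b0.
rewrite -(same_sign_PhiP _ _ _ c0 b012).
have sameij i j : class_N f g -> 0 < a i * b i * (a j * b j).
  by apply: (class_N_same_sign _ _ fg_distinct split) => k; exact: a0.
split=> [N|[s01 s02 s12]]; first by split; exact: sameij.
apply: (same_sign_class_N fg_distinct split c0).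
have sq i : 0 < a i * b i * (a i * b i).
  by rewrite -expr2 exprn_even_gt0 //= mulf_neq0 ?a0 ?b0.
by apply: ord3_ind; apply: ord3_ind => //; rewrite mulrC.
Qed.
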